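(* Let $Q$ be a nonzero quadratic form on $\mathbb{F}_{q_1}/\mathbb{F}_q$ with rank $r_Q\ge 1$, and let \[\mathcal{C}_Q=\{(aQ(x)+\mathrm{Tr}_{q_2/q}(by))_{(x,y)\in\mathbb{F}^\star} : (a,b)\in\mathbb{F}_q\times\mathbb{F}_{q_2}\}.\] (1) If $r_Q$ is even, then $\mathcal{C}_Q$ is a $[q^M-1,\,m_2+1]_q$ linear code whose weight distribution is: weight $0$ with frequency $1$; weight $q^{M-1}(q-1)$ with frequency $q(q^{m_2}-1)$; weight $q^{M-1}(q-1)(1-\epsilon q^{-r_Q/2})$ with frequency $q-1$. Its complete weight enumerator is \[\omega_0^{q^M-1}+q(q^{m_2}-1)\,\omega_0^{q^{M-1}-1}\prod_{\rho=1}^{q-1}\omega_\rho^{q^{M-1}}+(q-1)\,\omega_0^{q^{M-1}(1+\epsilon q^{-r_Q/2}(q-1))-1}\prod_{\rho=1}^{q-1}\omega_\rho^{q^{M-1}(1-\epsilon q^{-r_Q/2})}.\] (2) If $r_Q$ is odd, then $\mathcal{C}_Q$ is a $[q^M-1,\,m_2+1]_q$ linear code whose weight distribution is: weight $0$ with frequency $1$; weight $q^{M-1}(q-1)$ with frequency $q^{m_2+1}-1$. Its complete weight enumerator is \[\omega_0^{q^M-1}+q(q^{m_2}-1)\,\omega_0^{q^{M-1}-1}\prod_{\rho=1}^{q-1}\omega_\rho^{q^{M-1}}+\frac{q-1}{2}\,\omega_0^{q^{M-1}-1}\prod_{\rho=1}^{q-1}\omega_\rho^{q^{M-1}(1+\epsilon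 q^{\frac{1-r_Q}{2}}\eta(-\omega_\rho))}+\frac{q-1}{2}\,\omega_0^{q^{M-1}-1}\prod_{\rho=1}^{q-1}\omega_\rho^{q^{M-1}(1-\epsilon q^{\frac{1-r_Q}{2}}\eta(-\omega_\rho))}.\] Moreover, in this case $\mathcal{C}_Q$ meets the Griesmer bound (with equality) if and only if $m_1=r_Q=1$.
   Context: Let $p$ be an odd prime, $m\ge1$, $q=p^m$. Let $m_1,m_2$ be positive integers, $M=m_1+m_2$, $q_i=q^{m_i}$ ($i=1,2$), $\mathbb{F}=\mathbb{F}_{q_1}\times\mathbb{F}_{q_2}$, $\mathbb{F}^\star=\mathbb{F}\setminus\{(0,0)\}$; coordinates of codewords are indexed by $\mathbb{F}^\star$ in a fixed order. $\mathrm{Tr}_{q^s/q}$ denotes the trace from $\mathbb{F}_{q^s}$ to $\mathbb{F}_q$. $\eta$ is the quadratic character of $\mathbb{F}_q$ with $\eta(0)=0$. A quadratic form $Q$ on $\mathbb{F}_{q_1}/\mathbb{F}_q$ is a map $Q:\mathbb{F}_{q_1}\to\mathbb{F}_q$ with $Q(ax)=a^2Q(x)$ for $a\in\mathbb{F}_q$ such that $B_Q(x,y)=\frac12(Q(x+y)-Q(x)-Q(y))$ is $\mathbb{F}_q$-bilinear. Its rank is $r_Q=m_1-\dim_{\mathbb{F}_q}\{x: B_Q(x,y)=0\ \forall y\}$. In suitable $\mathbb{F}_q$-coordinates $Q=\lambda_1x_1^2+\dots+\lambda_{r_Q}x_{r_Q}^2$ with $\lambda_i\in\mathbb{F}_q^*$;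 set $\Delta_Q=\lambda_1\cdots\lambda_{r_Q}$ and $\varepsilon_Q=\eta(\Delta_Q)$. Define $\epsilon=\varepsilon_Q(-1)^{(p-1)mr_Q/4}$ if $r_Q$ is even and $\epsilon=\varepsilon_Q(-1)^{(p-1)m(r_Q+1)/4}$ if $r_Q$ is odd. Complete weight enumerator: list $\mathbb{F}_q=\{\omega_0=0,\omega_1,\dots,\omega_{q-1}\}$; for $c\in\mathbb{F}_q^n$ let $\omega[c]=\prod_j\omega_j^{k_j}$ (formal monomial) where $k_j$ is the number of coordinates of $c$ equal to $\omega_j$; the complete weight enumerator of a code $\mathcal{C}$ is $\sum_{c\in\mathcal{C}}\omega[c]$. The Griesmer bound for an $[n,k,d]_q$ code is $n\ge\sum_{i=0}^{k-1}\lceil d/q^i\rceil$; meeting it means equality. *)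

(* Defs.v *)
From HB Require Import structures.
From mathcomp Require Import all_boot all_order all_algebra.
Set Implicit Arguments.
Unset Strict Implicit.
Unset Printing Implicit Defensive.
Import Order.TTheory GRing.Theory Num.Theory.
Local Open Scope ring_scope.

(* F plays the role of F_q; L1, L2 the roles of F_{q1}, F_{q2}, with the
   embeddings i1 : F -> L1, i2 : F -> L2 making them F-extensions. *)

(* Tr_{q^m2/q}(y) = sum_{j<m2} y^(q^j), which lies in i2(F); we return
   its (unique) preimage in F. *)
Definition trace_to (F L2 : finFieldType) (i2 : {rmorphism F -> L2})
  (m2 : nat) (y : L2) : F :=
  odflt 0 [pick a : F | i2 a == \sum_(j < m2) y ^+ (#|F| ^ j)%N].

Definition bilin_of (F L1 : finFieldType) (Q : L1 -> F) (x y : L1) : F :=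
  (Q (x + y) - Q x - Q y) / 2%:R.

Definition is_quadratic_form (F L1 : finFieldType) (i1 : {rmorphism F -> L1})
  (Q : L1 -> F) : Prop :=
  [/\ forall (a : F) x, Q (i1 a * x) = a ^+ 2 * Q x,
      forall x x' y, bilin_of Q (x + x') y = bilin_of Q x y + bilin_of Q x' y,
      forall x y y', bilin_of Q x (y + y') = bilin_of Q x y + bilin_of Q x y',
      forall (a : F) x y, bilin_of Q (i1 a * x) y = a * bilin_of Q x y
    & forall (a : F) x y, bilin_of Q x (i1 a * y) = a * bilin_of Q x y].

Definition radical (F L1 : finFieldType) (Q : L1 -> F) : {set L1} :=
  [set x : L1 | [forall y : L1, bilin_of Q x y == 0]].

(* r_Q = m1 - dim_{F_q} radical; the radical has q^dim elements. *)
Definition rankQ (F L1 : finFieldType) (m1 : nat) (Q : L1 -> F) : nat :=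
  (m1 - trunc_log #|F| #|radical Q|)%N.

(* e is an F-basis of L1 (the coordinate map is injective, and
   #|L1| = q^m1 is assumed separately) in whose coordinates
   Q = lam_0 x_0^2 + ... + lam_{r-1} x_{r-1}^2 with all lam_i nonzero. *)
Definition diagonalizes (F L1 : finFieldType) (i1 : {rmorphism F -> L1})
  (m1 r : nat) (Q : L1 -> F) (e : 'I_m1 -> L1) (lam : nat -> F) : Prop :=
  [/\ injective (fun c : {ffun 'I_m1 -> F} => \sum_(i < m1) i1 (c i) * e i),
      (r <= m1)%N,
      (forall i : nat, (i < r)%N -> lam i != 0)
    & forall c : {ffun 'I_m1 -> F},
        Q (\sum_(i < m1) i1 (c i) * e i) =
        \sum_(i < m1 | (i < r)%N) lam i * c i ^+ 2].

Definition qchar (F : finFieldType) (x : F) : rat :=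
  if x == 0 then 0 else if [exists y : F, y ^+ 2 == x] then 1 else -1.

Definition epsQ (F : finFieldType) (p m r : nat) (Delta : F) : rat :=
  qchar Delta * (-1) ^+ (((p - 1) %/ 2) * m *
                       (if odd r then r.+1 %/ 2 else r %/ 2))%N.

Definition Fstar (L1 L2 : finFieldType) : finType := {xy : L1 * L2 | xy != (0, 0)}.

Definition cw (F L1 L2 : finFieldType) (i2 : {rmorphism F -> L2}) (m2 : nat)
  (Q : L1 -> F) (a : F) (b : L2) : {ffun Fstar L1 L2 -> F} :=
  [ffun z : Fstar L1 L2 => a * Q (val z).1 + trace_to i2 m2 (b * (val z).2)].

Definition codeQ (F L1 L2 : finFieldType) (i2 : {rmorphism F -> L2}) (m2 : nat)
  (Q : L1 -> F) : {set {ffun Fstar L1 L2 -> F}} :=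
  [set cw i2 m2 Q ab.1 ab.2 | ab : F * L2].

Definition wt (F : finFieldType) (I : finType) (c : {ffun I -> F}) : nat :=
  #|[set z | c z != 0]|.

Definition is_linear_code (F : finFieldType) (I : finType)
  (C : {set {ffun I -> F}}) : Prop :=
  [/\ 0 \in C,
      forall c d, c \in C -> d \in C -> c + d \in C
    & forall (a : F) c, c \in C -> [ffun z => a * c z] \in C].

(* Complete weight enumerator, represented by its coefficients: the
   coefficient of the monomial prod_w w^(k w) is the number of codewords
   having exactly k w coordinates equal to w, for each w in F. *)
Definition composition (F : finFieldType) (I : finType) (c : {ffun I -> F})
  : {ffun F -> nat} := [ffun w => #|[set z | c z == w]|].

Definition cwe_coef (F : finFieldType) (I : finType)
  (C : {set {ffun I -> F}}) (k : {ffun F -> nat}) : nat :=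
  #|[set c in C | composition c == k]|.

(* A formal polynomial given as a list of terms (coefficient, exponent
   function w |-> exponent of the variable w); its coefficient at the
   monomial with exponent vector k. *)
Definition mono_is (F : finFieldType) (e : F -> rat) (k : {ffun F -> nat}) :=
  [forall w : F, (k w)%:R == e w].

Definition poly_coef (F : finFieldType) (terms : seq (rat * (F -> rat)))
  (k : {ffun F -> nat}) : rat :=
  \sum_(t <- terms) t.1 * (mono_is t.2 k)%:R.

Definition is_min_dist (F : finFieldType) (I : finType)
  (C : {set {ffun I -> F}}) (d : nat) : Prop :=
  (exists2 c, c \in C & (c != 0) && (wt c == d)) /\
  (forall c, c \in C -> c != 0 -> (d <= wt c)%N).

Definition griesmer_sum (q k d : nat) : nat :=
  \sum_(i < k) ((d + q ^ i).-1 %/ q ^ i)%N.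

Definition meets_griesmer (F : finFieldType) (I : finType)
  (C : {set {ffun I -> F}}) (k : nat) : Prop :=
  exists d, is_min_dist C d /\ #|I| = griesmer_sum #|F| k d.

(* Main.v *)
(* Count, for every codeword aQ(x) + Tr(by), how often each value of F occurs on
   L1 x L2 (the excluded point (0, 0) only contributes one extra 0).  If b <> 0
   then Tr(by) is equidistributed, hence so is the word.  If b = 0 the count
   reduces to the number of solutions of lam_0 x_0^2 + ... = v, which follows
   from an induction on the number of variables using the sums over u of
   eta(v - x u^2). *)
Require Import Defs.
From HB Require Import structures.
From mathcomp Require Import all_boot all_order all_fingroup all_algebra all_solvable all_field.
From mathcomp Require Import ring zify.
Import Order.TTheory GRing.Theory Num.Theory.
Local Open Scope ring_scope.

(** * Cardinalities as rational sums of indicators *)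

Lemma natr_card_set (T : finType) (P : pred T) :
  #|[set x | P x]|%:R = \sum_x (P x)%:R :> rat.
Proof.
rewrite cardsE -sum1_card natr_sum big_mkcond /=.
by apply: eq_bigr => x _; rewrite unfold_in; case: (P x).
Qed.

Lemma sum_indicator (T : finType) (a : T) : \sum_x (x == a)%:R = 1 :> rat.
Proof. by rewrite -natr_card_set cardsE card1. Qed.

Lemma sumr_cst (T : finType) (x : rat) : \sum_(i : T) x = #|T|%:R * x.
Proof. by rewrite sumr_const mulr_natl. Qed.

(** * The quadratic character of a field of odd order *)

Section QuadraticCharacter.

Variable F : finFieldType.
Hypothesis oddF : odd #|F|.
Let q : rat := #|F|%:R.

Lemma card_field_neq0 : q != 0.
Proof. by rewrite pnatr_eq0 -lt0n (ltn_trans _ (finNzRing_gt1 F)). Qed.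

(** By Lagrange in the additive group, [#|F|] times 1 vanishes; if 2 vanished too, the odd number
    [#|F|] would reduce to 1 in [F]. *)
Lemma two_neq0 : 2%:R != 0 :> F.
Proof.
apply/eqP=> two0.
have: (#|F|%:R : F) == 0.
  by have := order_dvdG (in_setT (1 : F)); rewrite cardsT order_dvdn FinRing.zmodXgE.
by rewrite -(odd_double_half #|F|) oddF natrD -muln2 natrM two0 mulr0 addr0 oner_eq0.
Qed.

Lemma neq_oppr (x : F) : x != 0 -> x != - x.
Proof.
by move=> x0; rewrite -subr_eq0 opprK -mulr2n -mulr_natl mulf_neq0 // two_neq0.
Qed.

Lemma qchar0 : qchar (0 : F) = 0.
Proof. by rewrite /qchar eqxx. Qed.

(** A nonzero square has exactly the roots [y] and [- y], distinct in odd characteristic. *)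
Lemma sqrt_count (t : F) : \sum_(u : F) (u ^+ 2 == t)%:R = 1 + qchar t :> rat.
Proof.
rewrite /qchar; case: eqP => [->|/eqP t0].
  by under eq_bigr do rewrite sqrf_eq0; rewrite sum_indicator addr0.
case: existsP => [[y /eqP yt]|nsq]; last first.
  by rewrite subrr big1 // => u _; case: eqP => // /eqP ut; case: nsq; exists u.
have y0 : y != 0 by apply: contraNneq t0 => y0; rewrite -yt y0 expr0n.
transitivity (\sum_u ((u == y)%:R + (u == - y)%:R) : rat); last first.
  by rewrite big_split /= !sum_indicator.
apply: eq_bigr => u _; rewrite -yt eqf_sqr -natrD.
by have [->|] := eqVneq u y; rewrite // (negbTE (neq_oppr _ y0)).
Qed.

(** Summing the root counts [1 + qchar t] over all [t] counts every [u] once, at [t = u ^+ 2]. *)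
Lemma sum_qchar : \sum_(t : F) qchar t = 0.
Proof.
have: \sum_(t : F) (1 + qchar t) = q.
  rewrite (eq_bigr _ (fun t _ => esym (sqrt_count t))) exchange_big /=.
  rewrite (eq_bigr (fun=> 1)) ?sumr_cst ?mulr1 // => u _.
  by rewrite -[RHS](sum_indicator _ (u ^+ 2)); apply: eq_bigr => t _; rewrite eq_sym.
by rewrite big_split /= sumr_cst mulr1 -/q => /(canRL (addKr _)); rewrite addNr.
Qed.

Lemma qchar_cases (x : F) : x != 0 -> qchar x = 1 \/ qchar x = -1.
Proof. by rewrite /qchar => /negbTE->; case: ifP; [left|right]. Qed.

Lemma qchar_sign_count (s : rat) : s = 1 \/ s = -1 ->
  \sum_(t : F) (qchar t == s)%:R = (q - 1) / 2%:R.
Proof.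
move=> s1.
(* Interpolation of the indicator on the values 0, 1, -1 of [qchar]; its sum then needs only
   [sum_qchar]. *)
have ind (t : F) : (qchar t == s)%:R = (1 - (t == 0)%:R + s * qchar t) / 2%:R :> rat.
  have [->|t0] := eqVneq t 0; first by rewrite qchar0; case: s1 => ->.
  by case: (qchar_cases _ t0) => ->; case: s1 => ->.
under eq_bigr do rewrite ind.
rewrite -mulr_suml !big_split /= -mulr_sumr sum_qchar sumrN sum_indicator.
by rewrite sumr_cst mulr1 mulr0 addr0.
Qed.

Lemma odd_card_half : #|F| = (#|F|./2).*2.+1.
Proof. by rewrite -[LHS]odd_double_half oddF. Qed.

Lemma qchar_eq1 (x : F) : x != 0 -> (qchar x == 1) = (x ^+ #|F|./2 == 1).
Proof.
have fermat (y : F) : y != 0 -> y ^+ (#|F|./2).*2 = 1.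
  by move=> y0; apply: (mulfI y0); rewrite mulr1 -exprS -odd_card_half expf_card.
have sq1 (y : F) : qchar y == 1 -> y ^+ #|F|./2 = 1.
  rewrite /qchar; case: (eqVneq y 0) => // y0; case: ifP => // /existsP[z /eqP zy] _.
  by rewrite -zy -exprM mul2n fermat //; apply: contraNneq y0 => z0; rewrite -zy z0 expr0n.
move=> x0; apply/idP/idP => [/sq1/eqP //|xh].
(* The squares already exhaust the roots of X^((q-1)/2) - 1. *)
apply: contraTT isT => nx1; pose S := [set t : F | qchar t == 1].
have h0 : (0 < #|F|./2)%N by have := finNzRing_gt1 F; rewrite {1}odd_card_half; case: #|F|./2.
have cS : #|S| = #|F|./2.
  apply/eqP; rewrite -(eqr_nat rat) natr_card_set qchar_sign_count; last by left.
  by rewrite /q {1}odd_card_half -addn1 natrD addrK -muln2 natrM mulfK.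
have P0 : 'X^(#|F|./2) - 1%:P != 0 :> {poly F} by rewrite -size_poly_eq0 size_XnsubC.
have := @max_poly_roots _ _ (x :: enum S) P0.
rewrite /= enum_uniq mem_enum inE nx1 size_XnsubC // -cardE cS ltnn.
rewrite rootE !hornerE (eqP xh) subrr eqxx /= => -> //.
by apply/allP => y; rewrite mem_enum inE => /sq1 yh; rewrite rootE !hornerE yh subrr.
Qed.

Lemma half_power_cases (x : F) : x != 0 -> x ^+ #|F|./2 = 1 \/ x ^+ #|F|./2 = -1.
Proof.
move=> x0; have: (x ^+ #|F|./2) ^+ 2 == 1.
  rewrite -exprM muln2; apply/eqP/(mulfI x0).
  by rewrite mulr1 -exprS -odd_card_half expf_card.
by rewrite sqrf_eq1 => /orP[] /eqP; [left|right].
Qed.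

(** Euler's criterion replaces [qchar] by the power map with exponent (q - 1)/2, which is
    multiplicative. *)
Lemma qcharM (x y : F) : qchar (x * y) = qchar x * qchar y.
Proof.
have [->|x0] := eqVneq x 0; first by rewrite mul0r qchar0 mul0r.
have [->|y0] := eqVneq y 0; first by rewrite mulr0 qchar0 mulr0.
have euler (z : F) : z != 0 -> qchar z = if z ^+ #|F|./2 == 1 then 1 else -1.
  by move=> z0; rewrite -qchar_eq1 //; case: (qchar_cases _ z0) => ->.
rewrite !euler ?mulf_neq0 // exprMn.
have N1 : (-1 == 1 :> F) = false by rewrite eq_sym (negbTE (neq_oppr _ (oner_neq0 F))).
by case: (half_power_cases _ x0) => ->; case: (half_power_cases _ y0) => ->;
  rewrite ?mulr1 ?mul1r ?mulrNN ?mulr1 ?N1 ?eqxx ?mulrNN ?mulr1.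
Qed.

Lemma qchar1 : qchar (1 : F) = 1.
Proof.
by rewrite /qchar oner_eq0; case: existsP => // -[]; exists 1; rewrite expr1n.
Qed.

Lemma qchar_sqr (x : F) : x != 0 -> qchar x * qchar x = 1.
Proof. by case/qchar_cases => ->. Qed.

Lemma qcharV (x : F) : qchar x^-1 = qchar x.
Proof.
have [->|x0] := eqVneq x 0; first by rewrite invr0.
by rewrite -[LHS]mul1r -(qchar_sqr x x0) -mulrA -qcharM divff // qchar1 mulr1.
Qed.

(** Euler's criterion at -1; the powers of -1 in [F] and in [rat] are compared through the parity of
    their common exponent. *)
Lemma qcharN1 : qchar (-1 : F) = (-1) ^+ #|F|./2.
Proof.
have N1 : -1 != 0 :> F by rewrite oppr_eq0 oner_eq0.
have := qchar_eq1 _ N1; rewrite -(signr_odd F) -(signr_odd rat).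
case: odd; case: (qchar_cases _ N1) => ->; rewrite ?expr1 ?expr0 ?eqxx // => /esym.
by rewrite eq_sym (negbTE (neq_oppr _ (oner_neq0 F))).
Qed.

Lemma sum_qchar_sqrB (c : F) :
  \sum_u qchar (u ^+ 2 - c) = (c == 0)%:R * q - 1.
Proof.
have [->|c0] := eqVneq c 0.
  transitivity (\sum_(u : F) (1 - (u == 0)%:R) : rat); last first.
    by rewrite big_split /= sumrN sum_indicator sumr_cst mulr1 mul1r.
  apply: eq_bigr => u _; rewrite subr0; have [->|u0] := eqVneq u 0.
    by rewrite expr0n qchar0 subrr.
  by rewrite expr2 qcharM qchar_sqr // subr0.
(* Adding [q] as a sum of ones turns each summand into [1 + qchar], a number of square roots, so the
   points of t^2 = u^2 - c get counted. *)
rewrite mul0r add0r; apply: (addrI q); rewrite -[in LHS](mulr1 q) -sumr_cst -big_split /=.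
(* With t = u - s, the equation t^2 = u^2 - c becomes s (2 u - s) = c, which is
   linear in u. *)
under eq_bigr => u _.
  rewrite -sqrt_count (reindex_inj (addrI u)) /=.
  rewrite (reindex_inj oppr_inj) /=; over.
rewrite exchange_big /= (bigD1 0) //= big1 => [|u _]; last first.
  by rewrite subr0 -subr_eq0 opprB addrC subrK (negbTE c0).
rewrite add0r (eq_bigr (fun=> 1)) => [|s s0].
  rewrite sumr_const cardC1 -subn1 natrB //.
  by rewrite (ltn_trans _ (finNzRing_gt1 F)).
(* For nonzero [s] this is the unique [u] solving s (2 u - s) = c. *)
rewrite -[RHS](sum_indicator _ ((c / s + s) / 2%:R)); apply: eq_bigr => u _; congr (_%:R).
have t0 := two_neq0.
rewrite -[in RHS](inj_eq (mulIf t0)) divfK // -[in RHS](inj_eq (mulIf s0)) mulrDl divfK //.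
by rewrite -subr_eq0 -[in RHS]subr_eq0 -oppr_eq0; congr (_ == _); ring.
Qed.

End QuadraticCharacter.

(** * Solution counts of diagonal quadratic equations *)

Section DiagonalForms.

Variable F : finFieldType.
Hypothesis oddF : odd #|F|.
Let q : rat := #|F|%:R.

(** [lam] is defined on all naturals, so an induction on [n] can drop the last variable and keep the
    same coefficients. *)
Definition diag_count (n : nat) (lam : nat -> F) (v : F) : rat :=
  \sum_(c : {ffun 'I_n -> F}) (\sum_(i < n) lam i * c i ^+ 2 == v)%:R.

Lemma diag_count0 lam v : diag_count 0 lam v = (v == 0)%:R.
Proof.
rewrite /diag_count (bigD1 [ffun=> 0]) //= [X in _ + X]big1 => [|c]; last first.
  by case/eqP; apply/ffunP=> -[].
by rewrite addr0 big_ord0 eq_sym.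
Qed.

Lemma diag_countS n lam v :
  diag_count n.+1 lam v = \sum_u diag_count n lam (v - lam n * u ^+ 2).
Proof.
rewrite pair_big /=.
(* [ext] and [res] are the inverse bijections that set the last coordinate apart. *)
pose ext (uc : F * {ffun 'I_n -> F}) : {ffun 'I_n.+1 -> F} :=
  [ffun i => if unlift ord_max i is Some j then uc.2 j else uc.1].
pose res (c : {ffun 'I_n.+1 -> F}) :=
  (c ord_max, [ffun j => c (lift ord_max j)] : {ffun 'I_n -> F}).
rewrite /diag_count (reindex ext) /=; last first.
  exists res => [[u c] _|c _]; rewrite /res /ext.
    by rewrite ffunE unlift_none; congr pair; apply/ffunP=> j; rewrite !ffunE liftK.
  by apply/ffunP=> i; rewrite ffunE; case: unliftP => [j ->|->]; rewrite ?ffunE.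
apply: eq_bigr => -[u c] _; rewrite big_ord_recr /= ffunE unlift_none /=.
under eq_bigr => i _.
  rewrite ffunE (_ : widen_ord _ i = lift ord_max i) ?liftK; last first.
    by apply/val_inj; rewrite /= /bump leqNgt ltn_ord.
  over.
by rewrite [in RHS]eq_sym subr_eq eq_sym.
Qed.

(** A variable with coefficient 0 is free and multiplies the count by [q]. *)
Lemma diag_count_pad r n lam v : (r <= n)%N -> (forall i, (r <= i)%N -> lam i = 0) ->
  diag_count n lam v = q ^+ (n - r) * diag_count r lam v.
Proof.
move=> /subnKC <- lam0; move: (n - r)%N => k; rewrite addKn.
elim: k => [|k IHk]; first by rewrite addn0 mul1r.
rewrite addnS diag_countS lam0 ?leq_addr //.
by under eq_bigr do rewrite mul0r subr0 IHk; rewrite sumr_cst exprS mulrA.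
Qed.

Lemma sum_sqr_eq (x v : F) : x != 0 -> \sum_u (v - x * u ^+ 2 == 0)%:R = 1 + qchar (x * v) :> rat.
Proof.
move=> x0; rewrite qcharM // -(qcharV F oddF x) -qcharM // -sqrt_count //.
apply: eq_bigr => u _; congr (_%:R); congr nat_of_bool.
by rewrite subr_eq0 -[in RHS](inj_eq (mulfI x0)) mulVKf // eq_sym.
Qed.

(** Factoring out [- x] leaves u^2 - v/x, to which [sum_qchar_sqrB] applies. *)
Lemma sum_qchar_sub_sqr (x v : F) : x != 0 ->
  \sum_u qchar (v - x * u ^+ 2) = qchar (- x) * (q * (v == 0)%:R - 1).
Proof.
move=> x0; rewrite mulrC [q * _]mulrC.
have -> : (v == 0) = (v / x == 0) by rewrite mulf_eq0 invr_eq0 (negbTE x0) orbF.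
rewrite -sum_qchar_sqrB // mulrC mulr_sumr; apply: eq_bigr => u _.
by rewrite -qcharM //; congr qchar; field.
Qed.

(** Adding a variable exchanges the two shapes of the error term. The main term is [q ^+ n / q], not
    a power with exponent n - 1, so that the induction can start at n = 0. *)
Lemma diag_count_formula n lam v : (forall i, (i < n)%N -> lam i != 0) ->
  diag_count n lam v =
  q ^+ n / q + q ^+ n./2 * qchar ((-1) ^+ n./2 * \prod_(i < n) lam i) *
    (if odd n then qchar v else (v == 0)%:R - q^-1).
Proof.
have q0 : q != 0 := card_field_neq0 F.
elim: n v => [|n IHn] v lam0.
  by rewrite diag_count0 !mul1r big_ord0 qchar1 mul1r addrC subrK.
have {}IHn w : diag_count n lam w = _ := IHn w (fun i lt_in => lam0 i (ltnW lt_in)).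
have x0 := lam0 n (ltnSn n).
rewrite diag_countS (eq_bigr _ (fun u _ => IHn _)) big_split /= sumr_cst -/q.
rewrite -mulr_sumr uphalf_half big_ord_recr /=; move: (\prod_(i < n) _) => D.
congr (_ + _); first by rewrite exprS mulrA.
case: (odd n) => /=.
  (* From odd to even: the character sums to an indicator, and [qchar (- x)] supplies the new factor
     -1 beside the product. *)
  rewrite sum_qchar_sub_sqr // -(mulN1r (lam n)) add1n !exprS !qcharM //.
  by field.
(* From even to odd: the indicator sums to 1 + qchar (x v), and this 1 cancels against the [q]
   copies of [q^-1]. *)
rewrite big_split /= sum_sqr_eq // sumr_cst -/q !qcharM // add0n.
by field.
Qed.

End DiagonalForms.

(** * The trace: linearity, surjectivity and fibre sizes *)

Section Trace.

Variables (p m n : nat) (F L : finFieldType) (i : {rmorphism F -> L}).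
Hypotheses (pr_p : prime p) (cardF : #|F| = (p ^ m)%N).
Hypotheses (n_gt0 : (0 < n)%N) (cardL : #|L| = (#|F| ^ n)%N).

Local Notation tr := (trace_to i n).

Lemma frobD (j : nat) (x y : L) :
  (x + y) ^+ (#|F| ^ j) = x ^+ (#|F| ^ j) + y ^+ (#|F| ^ j).
Proof.
rewrite exprDn_pchar // pnatX; apply/orP; left.
rewrite cardF pnatX pnatE //; apply/orP; left.
exact: rmorph_pchar (card_finPcharP cardF pr_p).
Qed.

(** Over [F], X^q - X is the product of all X - a; mapped to [L], it has no roots outside the image
    of [i]. *)
Lemma frob_fixed (y : L) : y ^+ #|F| = y -> exists a, y = i a.
Proof.
move=> yq; have := congr1 (fun P => (map_poly i P).[y]) (finField_genPoly F).
rewrite rmorphB rmorph_prod /= map_polyXn map_polyX !hornerE yq subrr => /esym/eqP.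
rewrite horner_prod => /prodf_eq0[a _].
by rewrite rmorphB /= map_polyX map_polyC !hornerE subr_eq0 => /eqP; exists a.
Qed.

Lemma frob_sum (I : finType) (f : I -> L) :
  (\sum_k f k) ^+ #|F| = \sum_k f k ^+ #|F|.
Proof.
apply: (big_morph (fun x => x ^+ #|F|)) => [x y|].
  by have := frobD 1 x y; rewrite expn1.
by rewrite expr0n; case: #|F| (finNzRing_gt1 F).
Qed.

(** The default value in [trace_to] is never taken: as y^(q^n) = y, Frobenius permutes the summands
    cyclically, so the sum is fixed and lies in the image of [i]. *)
Lemma trace_toE (y : L) : i (tr y) = \sum_(j < n) y ^+ (#|F| ^ j).
Proof.
rewrite /trace_to; case: pickP => [a /eqP //|noa].
have [a ta] : exists a, \sum_(j < n) y ^+ (#|F| ^ j) = i a.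
  apply: frob_fixed; rewrite frob_sum.
  under eq_bigr do rewrite -exprM -expnSr.
  case: n n_gt0 cardL => // k _ cardLk; rewrite big_ord_recr /= -cardLk expf_card.
  by rewrite [RHS]big_ord_recl /= expr1 addrC.
by have := noa a; rewrite -ta eqxx.
Qed.

Lemma trace_toD x y : tr (x + y) = tr x + tr y.
Proof.
apply: (fmorph_inj i); rewrite rmorphD /= !trace_toE -big_split /=.
by apply: eq_bigr => j _; rewrite frobD.
Qed.

Lemma trace_toZ a y : tr (i a * y) = a * tr y.
Proof.
apply: (fmorph_inj i); rewrite rmorphM /= !trace_toE mulr_sumr.
apply: eq_bigr => j _; rewrite exprMn; congr (_ * _).
by elim: {j}(val j) => [|j IHj]; rewrite ?expr1 // expnSr exprM IHj -rmorphXn expf_card.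
Qed.

Lemma trace_to0 : tr 0 = 0.
Proof. by rewrite -(mulr0 (i 0)) trace_toZ mul0r. Qed.

(* The polynomial defining the trace has degree q^(n-1) < |L|. *)
Lemma trace_to_surj a : exists y, tr y = a.
Proof.
suff [y ty]: exists y, tr y != 0.
  by exists (i (a / tr y) * y); rewrite trace_toZ divfK.
apply/existsP; apply: contraT => /existsPn tr0.
pose P : {poly L} := \sum_(j < n) 'X^(#|F| ^ j).
have q1 := finNzRing_gt1 F.
have P0 : P != 0.
  (* The coefficient of X is 1: only the summand j = 0 has degree 1. *)
  apply/eqP => /(congr1 (coefp 1)) /eqP; rewrite /= coef_sum coef0.
  rewrite -(prednK n_gt0) big_ord_recl /= coefXn big1 ?addr0 ?oner_eq0 // => j _.
  by rewrite coefXn /bump /= -{1}(expn0 #|F|) eqn_exp2l.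
have := @max_poly_roots _ _ (enum L) P0; rewrite enum_uniq -cardE cardL.
suff -> : all (root P) (enum L).
  move=> /(_ isT isT); apply: contraTT => _; rewrite -leqNgt.
  apply: leq_trans (size_sum _ _ _) _; apply/bigmax_leqP => j _.
  by rewrite size_polyXn ltn_exp2l.
apply/allP => y _; rewrite rootE horner_sum.
under eq_bigr do rewrite hornerXn.
by rewrite -trace_toE; have := tr0 y; rewrite negbK => /eqP->; rewrite rmorph0.
Qed.

(** Multiplication by [b] permutes [L], and by additivity and surjectivity the q fibres of the trace
    are translates of one another. *)
Lemma trace_to_fiber (b : L) w : b != 0 ->
  \sum_y (tr (b * y) == w)%:R = #|F|%:R ^+ n.-1 :> rat.
Proof.
move=> b0; transitivity (\sum_y (tr y == w)%:R : rat).
  by rewrite [RHS](reindex_inj (mulfI b0)).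
have fib v : \sum_y (tr y == v)%:R = \sum_y (tr y == 0)%:R :> rat.
  have [z <-] := trace_to_surj v; rewrite (reindex_inj (addrI z)).
  by apply: eq_bigr => y _; rewrite trace_toD -subr_eq0 addrC addKr.
have: \sum_v \sum_y (tr y == v)%:R = #|L|%:R :> rat.
  rewrite exchange_big /= (eq_bigr (fun=> 1)) ?sumr_cst ?mulr1 // => y _.
  by rewrite -[RHS](sum_indicator _ (tr y)); apply: eq_bigr => v _; rewrite eq_sym.
rewrite (eq_bigr _ (fun v _ => fib v)) fib sumr_cst cardL natrX.
by rewrite -{2}(prednK n_gt0) exprS => /(mulfI (card_field_neq0 F)).
Qed.

End Trace.

(** * Parities, the Griesmer sum, and counting through injections *)

(** Modulo 2, halving turns products of odd numbers into sums. This links the exponent (q - 1)/2 of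
    Euler's criterion with the one in [epsQ]. *)
Lemma half_odd_exp (p m : nat) : odd p -> odd (p ^ m)./2 = odd ((p - 1) %/ 2 * m).
Proof.
move=> oddp; have p2 : p = (p./2).*2.+1 by rewrite -[LHS]odd_double_half oddp.
have -> : ((p - 1) %/ 2 = p./2)%N by rewrite {1}p2 subn1 /= -muln2 mulnK.
elim: m => [|m IHm]; first by rewrite muln0.
have pm2 : (p ^ m = (p ^ m)./2.*2.+1)%N by rewrite -[LHS]odd_double_half oddX oddp orbT.
rewrite mulnS oddD -IHm expnSr; move: (p ^ m)%N pm2 {IHm oddp} => P.
move: P./2 p./2 p2 => h k -> ->.
have -> : (h.*2.+1 * k.*2.+1 = (h * k.*2 + h + k).*2.+1)%N by lia.
by rewrite /= uphalf_double !oddD oddM odd_double andbF addbC.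
Qed.

(** Every i < k satisfies i <= n, so all ceilings are exact and the terms q^(n-i) (q - 1) telescope.
    The additive form avoids truncated subtraction. *)
Lemma griesmer_sum_geometric (q k n : nat) : (0 < q)%N -> (k <= n.+1)%N ->
  (griesmer_sum q k (q ^ n * (q - 1)) + q ^ (n.+1 - k) = q ^ n.+1)%N.
Proof.
move=> q0; elim: k => [|k IHk] kn; first by rewrite /griesmer_sum big_ord0 subn0.
rewrite /griesmer_sum big_ord_recr /= -/(griesmer_sum _ _ _) -(IHk (ltnW kn)) -addnA.
congr (_ + _)%N; rewrite subSS subSn //.
have qk : (0 < q ^ k)%N by rewrite expn_gt0 q0.
rewrite -(subnK (kn : k <= n)%N) expnD addnK mulnAC -(prednK qk) addnS /=.
by rewrite prednK // divnMDl // divn_small ?prednK // addn0 -mulnSr subn1 prednK // -expnSr.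
Qed.

Lemma card_imset_pred (T U : finType) (f : T -> U) (P : pred U) : injective f ->
  #|[set c in [set f x | x : T] | P c]|%:R = \sum_x (P (f x))%:R :> rat.
Proof.
move=> injf; rewrite -natr_card_set -(card_imset _ injf); congr (#|pred_of_set _|%:R).
apply/setP=> c; rewrite inE; apply/andP/imsetP => [[/imsetP[x _ ->] Px]|[x]].
  by exists x; rewrite ?inE.
by rewrite inE => Px ->; split; rewrite ?imset_f.
Qed.

Lemma form_count (F L : finFieldType) (i : {rmorphism F -> L}) (n r : nat)
  (Q : L -> F) (e : 'I_n -> L) (lam : nat -> F) (v : F) :
  #|L| = (#|F| ^ n)%N -> diagonalizes i r Q e lam ->
  \sum_x (Q x == v)%:R = #|F|%:R ^+ (n - r) * diag_count F r lam v.
Proof.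
move=> cardL [inj_e le_rn lam0 Qe].
set f := (fun c : {ffun _ -> _} => _) in inj_e.
have [g fK gK] : bijective f.
  by apply: inj_card_bij => //; rewrite card_ffun card_ord cardL.
(* [lam] is unconstrained from [r] on; setting it to 0 there makes the n - r remaining coordinates
   free variables. *)
pose lam' j := if (j < r)%N then lam j else 0.
have -> : diag_count F r lam v = diag_count F r lam' v.
  by do !apply: eq_bigr => ? _; congr (_ == _)%:R; apply: eq_bigr => j _; rewrite /lam' ltn_ord.
rewrite -diag_count_pad // => [|j le_rj]; last by rewrite /lam' ltnNge le_rj.
rewrite (reindex f); last by exists g => ? _.
apply: eq_bigr => c _; rewrite Qe big_mkcond /=; congr (_ == _)%:R.
by apply: eq_bigr => j _; rewrite /lam'; case: ifP; rewrite ?mul0r.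
Qed.

(** * Symbol counts of the codewords *)

Section Code.

Variables (p m m1 m2 : nat) (F L1 L2 : finFieldType).
Variables (i1 : {rmorphism F -> L1}) (i2 : {rmorphism F -> L2}).
Variables (Q : L1 -> F) (r : nat) (e : 'I_m1 -> L1) (lam : nat -> F).
Hypotheses (pr_p : prime p) (odd_p : odd p) (cardF : #|F| = (p ^ m)%N).
Hypotheses (m1_gt0 : (0 < m1)%N) (m2_gt0 : (0 < m2)%N).
Hypotheses (cardL1 : #|L1| = (#|F| ^ m1)%N) (cardL2 : #|L2| = (#|F| ^ m2)%N).
Hypotheses (Qhom : forall (a : F) x, Q (i1 a * x) = a ^+ 2 * Q x).
Hypotheses (Q_neq0 : exists x, Q x != 0) (diagQ : diagonalizes i1 r Q e lam).

Let q : rat := #|F|%:R.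
Let M := (m1 + m2)%N.
(** The sign produced by [diag_count_formula]; [epsQE] relates it to [epsQ]. *)
Let s : rat := qchar ((-1) ^+ r./2 * \prod_(i < r) lam i).
Local Notation tr := (trace_to i2 m2).
Local Notation cw := (cw i2 m2 Q).
Local Notation C := (codeQ i2 m2 Q).

Lemma odd_cardF : odd #|F|.
Proof. by rewrite cardF oddX odd_p orbT. Qed.

Let oddF := odd_cardF.
Let q0 : q != 0 := card_field_neq0 F.

Let tr0 := trace_to0 p m m2 F L2 i2 pr_p cardF m2_gt0 cardL2.

Lemma form0 : Q 0 = 0.
Proof. by rewrite -(mulr0 (i1 0)) Qhom expr0n mul0r. Qed.

Lemma cardX_ge1 n : (1 <= #|F| ^ n)%N.
Proof. by rewrite expn_gt0 (ltn_trans _ (finNzRing_gt1 F)). Qed.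

Lemma card_Fstar : #|Fstar L1 L2| = (#|F| ^ M - 1)%N.
Proof.
by rewrite card_sig (cardC1 ((0, 0) : L1 * L2)) card_prod cardL1 cardL2 -expnD subn1.
Qed.

Lemma compositionE a b w : (composition (cw a b) w)%:R =
  \sum_x \sum_y (a * Q x + tr (b * y) == w)%:R - (w == 0)%:R :> rat.
Proof.
rewrite ffunE natr_card_set pair_big /= [in RHS](bigD1 (0, 0)) //=.
rewrite form0 !mulr0 tr0 addr0 eq_sym addrC addrK.
pose g (z : L1 * L2) : rat := (a * Q z.1 + tr (b * z.2) == w)%:R.
rewrite -[RHS]/(\sum_(z | z \in [pred z | z != (0, 0)]) g z) (big_sub _ g).
by apply: eq_bigr => z _; rewrite ffunE.
Qed.

(** For each fixed [x], the trace condition on [y] has the same number of solutions, whatever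
    [a * Q x] is. *)
Lemma composition_trace a b w : b != 0 ->
  (composition (cw a b) w)%:R = q ^+ M.-1 - (w == 0)%:R.
Proof.
move=> b0; rewrite compositionE; congr (_ - _).
rewrite (eq_bigr (fun=> q ^+ m2.-1)) => [|x _].
  by rewrite sumr_cst cardL1 natrX -exprD /M -(prednK m2_gt0) addnS.
rewrite -(trace_to_fiber p m m2 F L2 i2 pr_p cardF m2_gt0 cardL2 b (w - a * Q x)) //.
by apply: eq_bigr => y _; rewrite [in RHS]eq_sym subr_eq addrC eq_sym.
Qed.

(** The coordinate [y] is free and gives q^m2; what remains is the number of solutions of Q x = w /
    a. *)
Lemma composition_form a w : a != 0 ->
  (composition (cw a 0) w)%:R = q ^+ M.-1 * (1 + s * q ^- r./2 *
     (if odd r then qchar w * qchar a else q * (w == 0)%:R - 1)) - (w == 0)%:R.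
Proof.
move=> a0; rewrite compositionE; congr (_ - _).
have [_ le_r lam0 _] := diagQ.
transitivity (q ^+ m2 * \sum_x (Q x == w / a)%:R).
  rewrite mulr_sumr; apply: eq_bigr => x _.
  under eq_bigr do rewrite mul0r tr0 addr0.
  by rewrite sumr_cst cardL2 natrX -[in RHS](inj_eq (mulfI a0)) mulrCA divff // mulr1.
rewrite (form_count F L1 i1 m1 r Q e lam) // diag_count_formula //.
rewrite mulf_eq0 invr_eq0 (negbTE a0) orbF -/s qcharM // qcharV // -/q.
(* The exponent is split as m2 + (m1 - r) + r - 1, and [r] into its two halves and its parity, to
   match the powers in the diagonal count. *)
have -> : q ^+ M.-1 = q ^+ m2 * q ^+ (m1 - r) * q ^+ r / q.
  apply: (mulIf q0); rewrite divfK // -exprSr prednK ?addn_gt0 ?m1_gt0 //.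
  by rewrite -!exprD -addnA subnK // addnC.
rewrite -[in q ^+ r](odd_double_half r) -addnn !exprD.
have qk : q ^+ r./2 != 0 by rewrite expf_neq0.
by case: (odd r); field; rewrite ?q0 ?qk.
Qed.



(** * Linearity and dimension of the code *)

Lemma cw0 : cw 0 0 = 0.
Proof. by apply/ffunP=> z; rewrite !ffunE !mul0r tr0 addr0. Qed.

Lemma cwD a b a' b' : cw a b + cw a' b' = cw (a + a') (b + b').
Proof.
apply/ffunP=> z; rewrite !ffunE !mulrDl (trace_toD p m m2 F L2 i2) //.
by rewrite addrACA.
Qed.

Lemma cwZ c a b : [ffun z => c * cw a b z] = cw (c * a) (i2 c * b).
Proof.
by apply/ffunP=> z; rewrite !ffunE mulrDr -!mulrA (trace_toZ p m m2 F L2 i2).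
Qed.

(** Evaluation at (x0, 0) with Q x0 nonzero detects [a]; evaluation at (0, y / b) with tr y = 1
    detects [b]. *)
Lemma cw_eq0 a b : cw a b = 0 -> a = 0 /\ b = 0.
Proof.
move=> ab0; split; apply/eqP; apply: contraT => n0.
  have [x0 Qx0] := Q_neq0.
  have z : (x0, 0) != (0, 0) :> L1 * L2.
    by rewrite xpair_eqE eqxx andbT; apply: contraNneq Qx0 => ->; rewrite form0.
  have /ffunP/(_ (exist (fun xy : L1 * L2 => xy != (0, 0)) _ z)) := ab0.
  by rewrite !ffunE /= mulr0 tr0 addr0 => /eqP; rewrite mulf_eq0 (negbTE n0) (negbTE Qx0).
have [y ty] := trace_to_surj p m m2 F L2 i2 pr_p cardF m2_gt0 cardL2 1.
have z : (0, y / b) != (0, 0) :> L1 * L2.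
  rewrite xpair_eqE eqxx mulf_eq0 invr_eq0 (negbTE n0) orbF.
  by apply: contra_eq_neq ty => ->; rewrite tr0 eq_sym oner_eq0.
have /ffunP/(_ (exist (fun xy : L1 * L2 => xy != (0, 0)) _ z)) := ab0.
rewrite !ffunE /= form0 mulr0 add0r mulrC divfK // ty => /eqP.
by rewrite oner_eq0.
Qed.

Lemma cw_inj : injective (fun ab : F * L2 => cw ab.1 ab.2).
Proof.
move=> [a b] [a' b'] /= eq_cw.
have [] := cw_eq0 (a + -1 * a') (b + i2 (-1) * b').
  by rewrite -cwD -cwZ eq_cw; apply/ffunP=> z; rewrite !ffunE mulN1r subrr.
by rewrite rmorphN1 !mulN1r => /eqP; rewrite subr_eq0 => /eqP-> /eqP; rewrite subr_eq0 => /eqP->.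
Qed.

Lemma codeQ_linear : is_linear_code C.
Proof.
split=> [|c d /imsetP[ab _ ->] /imsetP[cd _ ->]|a c /imsetP[bc _ ->]].
- by rewrite -cw0; apply/imsetP; exists (0, 0).
- by rewrite cwD; apply/imsetP; exists (ab.1 + cd.1, ab.2 + cd.2).
- by rewrite cwZ; apply/imsetP; exists (a * bc.1, i2 a * bc.2).
Qed.

Lemma card_codeQ : #|C| = (#|F| ^ m2.+1)%N.
Proof. by rewrite card_imset ?card_prod ?cardL2 ?expnS //; apply: cw_inj. Qed.

(** * Weight distribution and complete weight enumerator *)

Lemma sum_codeQ (P : pred {ffun Fstar L1 L2 -> F}) :
  #|[set c in C | P c]|%:R = (P 0)%:R + \sum_(a | a != 0) (P (cw a 0))%:R
    + \sum_(b | b != 0) \sum_a (P (cw a b))%:R :> rat.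
Proof.
rewrite card_imset_pred; last exact: cw_inj.
rewrite -(pair_bigA _ (fun a b => (P (cw a b))%:R)) /= exchange_big /=.
by rewrite (bigD1 0) //= (bigD1 0) //= cw0.
Qed.

Lemma sum_neq0_cst (T : finFieldType) (x : rat) :
  \sum_(a : T | a != 0) x = (#|T|%:R - 1) * x.
Proof.
by rewrite sumr_const cardC1 -[LHS]mulr_natl -subn1 natrB // (ltn_trans _ (finNzRing_gt1 T)).
Qed.

(** Bridges the natural exponents of [cwe_coef] and the rational ones of [poly_coef]. *)
Lemma composition_eq (c : {ffun Fstar L1 L2 -> F}) (E : F -> rat) (k : {ffun F -> nat}) :
  (forall w, (composition c w)%:R = E w) -> (composition c == k) = mono_is E k.
Proof.
move=> cE; apply/eqP/forallP => [<- w|kE]; first by rewrite cE.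
by apply/ffunP=> w; apply/eqP; rewrite -(eqr_nat rat) cE eq_sym kE.
Qed.

Lemma composition0 w :
  (composition (0 : {ffun Fstar L1 L2 -> F}) w)%:R =
  if w == 0 then (#|F| ^ M - 1)%N%:R else 0 :> rat.
Proof.
rewrite ffunE natr_card_set (eq_bigr (fun=> (w == 0)%:R)) => [|z _].
  by rewrite sumr_cst card_Fstar; case: ifP; rewrite ?mulr1 ?mulr0.
by rewrite ffunE eq_sym.
Qed.

Lemma wtE (c : {ffun Fstar L1 L2 -> F}) :
  (wt c)%:R = q ^+ M - 1 - (composition c 0)%:R :> rat.
Proof.
rewrite /q -natrX -(natrB _ (cardX_ge1 M)) -card_Fstar -cardsT.
rewrite -(cardsID [set z | c z != 0]) setTI natrD ffunE.
rewrite (_ : [set: _] :\: _ = [set z | c z == 0]) ?addrK //.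
by apply/setP=> z; rewrite !inE negbK andbT.
Qed.

(** Since qchar (-1) = (-1)^(m(p-1)/2), [epsQ] carries qchar (-1) to the power r/2 rounded up, and
    [s] to the power r/2 rounded down; they differ by one factor when [r] is odd. *)
Lemma epsQE : epsQ p m r (\prod_(i < r) lam i) = s * (if odd r then qchar (-1 : F) else 1).
Proof.
have N1 : qchar (-1 : F) = (-1) ^+ ((p - 1) %/ 2 * m).
  by rewrite qcharN1 // -signr_odd cardF half_odd_exp // signr_odd.
have qcharX k : qchar ((-1) ^+ k : F) = qchar (-1 : F) ^+ k.
  by elim: k => [|k IHk]; rewrite ?qchar1 // !exprS qcharM // IHk.
rewrite /epsQ /s qcharM // qcharX -[RHS]mulrA [RHS]mulrCA; congr (_ * _).
rewrite exprM -N1 !divn2 /= uphalf_half.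
by case: (odd r); rewrite ?mulr1 // add1n exprSr.
Qed.


Let eps : rat := epsQ p m r (\prod_(i < r) lam i).
Let W1 : rat := q ^+ M.-1 * (q - 1).

Lemma cardX_M : q ^+ M = q * q ^+ M.-1.
Proof. by rewrite -exprS prednK // addn_gt0 m1_gt0. Qed.

Lemma wt_trace a b : b != 0 -> (wt (cw a b))%:R = W1.
Proof.
by move=> b0; rewrite wtE composition_trace // eqxx cardX_M /W1 /=; ring.
Qed.

(** For odd [r] the deviation in the number of zeros is a multiple of [qchar 0], hence vanishes. *)
Lemma wt_form a : a != 0 ->
  (wt (cw a 0))%:R = if odd r then W1 else W1 * (1 - eps * q ^- (r %/ 2)).
Proof.
move=> a0; rewrite wtE composition_form // eqxx qchar0 cardX_M /W1 /eps epsQE divn2 /=.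
by case: (odd r); ring.
Qed.

Lemma wt0 : wt (0 : {ffun Fstar L1 L2 -> F}) = 0%N.
Proof. by apply/eqP; rewrite cards_eq0; apply/eqP/setP=> z; rewrite !inE ffunE eqxx. Qed.

Lemma sum_codeQ_const (P : pred {ffun Fstar L1 L2 -> F}) (x : rat) :
  (forall a b, b != 0 -> (P (cw a b))%:R = x) ->
  #|[set c in C | P c]|%:R =
  (P 0)%:R + \sum_(a | a != 0) (P (cw a 0))%:R + q * (q ^+ m2 - 1) * x.
Proof.
move=> Px; rewrite sum_codeQ; congr (_ + _).
rewrite (eq_bigr (fun=> q * x)) => [|b b0].
  by rewrite sum_neq0_cst cardL2 natrX mulrCA mulrA.
by rewrite (eq_bigr (fun=> x)) ?sumr_cst // => a _; rewrite Px.
Qed.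

Lemma weight_distribution w :
  #|[set c in C | wt c == w]|%:R = (w == 0%N)%:R
    + (w%:R == if odd r then W1 else W1 * (1 - eps * q ^- (r %/ 2)))%:R * (q - 1)
    + (w%:R == W1)%:R * (q * (q ^+ m2 - 1)) :> rat.
Proof.
rewrite (sum_codeQ_const _ (w%:R == W1)%:R) => [|a b b0]; last first.
  by rewrite -(eqr_nat rat) wt_trace // eq_sym.
rewrite wt0 eq_sym [in RHS]mulrC -[q * _ * _]mulrC.
congr (_ + _ + _); rewrite -sum_neq0_cst; apply: eq_bigr => a a0.
by rewrite -(eqr_nat rat) wt_form // eq_sym.
Qed.

Let term0 : rat * (F -> rat) :=
  (1 : rat, fun w : F => if w == 0 then (#|F| ^ M - 1)%N%:R else 0).
Let term1 : rat * (F -> rat) :=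
  (q * (q ^+ m2 - 1), fun w : F => if w == 0 then q ^+ M.-1 - 1 else q ^+ M.-1).

Lemma cwe_split k :
  (cwe_coef C k)%:R = (mono_is term0.2 k)%:R
    + \sum_(a | a != 0) (composition (cw a 0) == k)%:R
    + q * (q ^+ m2 - 1) * (mono_is term1.2 k)%:R.
Proof.
rewrite /cwe_coef (sum_codeQ_const _ (mono_is term1.2 k)%:R) => [|a b b0].
  by rewrite (composition_eq _ _ _ composition0).
rewrite (composition_eq _ term1.2) // => w.
by rewrite composition_trace //=; case: ifP; rewrite ?subr0.
Qed.

Lemma cwe_even k : ~~ odd r -> (cwe_coef C k)%:R =
  poly_coef
    [:: term0; term1;
        (q - 1,
         fun w : F =>
           if w == 0
           then q ^+ M.-1 * (1 + eps * q ^- (r %/ 2) * (q - 1)) - 1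
           else q ^+ M.-1 * (1 - eps * q ^- (r %/ 2)))] k.
Proof.
move=> even_r; rewrite cwe_split /poly_coef !big_cons big_nil /= mul1r addr0 addrAC -addrA.
congr (_ + (_ + _)); rewrite -sum_neq0_cst; apply: eq_bigr => a a0.
congr (_%:R); congr nat_of_bool; apply: composition_eq => w /=.
rewrite composition_form // /eps epsQE divn2 (negbTE even_r).
by case: eqP => _ /=; ring.
Qed.

(** The word of (a, 0) depends on [a] only through [qchar a], and each sign is taken by (q - 1)/2
    values of [a]. *)
Lemma cwe_odd k : odd r -> (cwe_coef C k)%:R =
  poly_coef
    [:: term0; term1;
        ((q - 1) / 2%:R,
         fun w : F =>
           if w == 0 then q ^+ M.-1 - 1
           else q ^+ M.-1 * (1 + eps * q ^- ((r - 1) %/ 2) * qchar (- w)));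
        ((q - 1) / 2%:R,
         fun w : F =>
           if w == 0 then q ^+ M.-1 - 1
           else q ^+ M.-1 * (1 - eps * q ^- ((r - 1) %/ 2) * qchar (- w)))] k.
Proof.
move=> odd_r; rewrite cwe_split /poly_coef !big_cons big_nil /= mul1r addr0 addrAC -addrA.
congr (_ + (_ + _)); set Ep := (X in mono_is X k); set En := (X in _ + _ * (mono_is X k)%:R).
have comp_a (a : F) : a != 0 -> composition (cw a 0) == k = mono_is (if qchar a == 1 then Ep else En) k.
  move=> a0; apply: composition_eq => w.
  have -> : (if qchar a == 1 then Ep else En) w = if w == 0 then q ^+ M.-1 - 1
     else q ^+ M.-1 * (1 + qchar a * eps * q ^- ((r - 1) %/ 2) * qchar (- w)).
    by rewrite /Ep /En; case: (qchar_cases _ _ a0) => ->; rewrite ?mul1r ?mulN1r ?mulNr.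
  rewrite composition_form // /eps epsQE odd_r -(mulN1r w) qcharM //.
  have -> : ((r - 1) %/ 2 = r./2)%N by rewrite divn2 -{1}(odd_double_half r) odd_r addKn doubleK.
  (* [epsQ] contributes one qchar (-1) and qchar (- w) another; they cancel, leaving s qchar w. *)
  have n11 : qchar (-1 : F) * qchar (-1 : F) = 1 by rewrite qchar_sqr // oppr_eq0 oner_eq0.
  case: (eqVneq w 0) => [->|_] /=; first by rewrite qchar0; ring.
  by rewrite -[s in LHS]mulr1 -n11; ring.
(* The sum can run over all [a], since [qchar 0] is neither 1 nor -1. *)
transitivity (\sum_(a : F) ((qchar a == 1)%:R * (mono_is Ep k)%:R
                     + (qchar a == -1)%:R * (mono_is En k)%:R) : rat).
  rewrite [RHS](bigD1 0) //= qchar0 !mul0r add0r; apply: eq_bigr => a a0.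
  rewrite comp_a //; case: (qchar_cases _ _ a0) => ->; rewrite ?eqxx /=; ring.
by rewrite big_split /= -!mulr_suml !qchar_sign_count //; [right|left].
Qed.

(** * The Griesmer bound *)

(** All nonzero words have weight q^(M-1) (q - 1), so the Griesmer sum is q^M - q^(m1-1). It equals
    the length q^M - 1 exactly when m1 = 1, and then the odd rank r <= m1 is 1. *)
Lemma codeQ_griesmer : odd r -> meets_griesmer C m2.+1 <-> m1 = 1%N /\ r = 1%N.
Proof.
move=> odd_r; have [_ le_r _ _] := diagQ.
have wt_nz a b : cw a b != 0 -> wt (cw a b) = (#|F| ^ M.-1 * (#|F| - 1))%N.
  move=> ab0; apply/eqP; rewrite -(eqr_nat rat) natrM natrX natrB; last exact: (cardX_ge1 1).
  have [b0|/wt_trace-> //] := eqVneq b 0; rewrite b0 in ab0 *.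
  by rewrite wt_form ?odd_r //; apply: contraNneq ab0 => ->; rewrite cw0.
have le_m2 : (m2.+1 <= M.-1.+1)%N by rewrite prednK /M; lia.
have sumG := griesmer_sum_geometric _ _ _ (cardX_ge1 1) le_m2.
have M1 : M.-1.+1 = M by rewrite prednK /M; lia.
have Mm2 : (M.-1.+1 - m2.+1 = m1.-1)%N by rewrite M1 /M; lia.
rewrite expn1 Mm2 M1 in sumG.
have q1 := finNzRing_gt1 F.
split=> [[d [[[c /imsetP[ab _ ->] /andP[c0 /eqP dE]] _]]]|[m1_1 _]].
  rewrite -dE wt_nz // card_Fstar -sumG.
  have := cardX_ge1 m1.-1; case: (posnP m1.-1) => [m10 _ _|m1p]; first by lia.
  have : (1 < #|F| ^ m1.-1)%N by rewrite -(expn0 #|F|) ltn_exp2l.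
  by lia.
exists (#|F| ^ M.-1 * (#|F| - 1))%N; split; last first.
  by rewrite card_Fstar -sumG m1_1 expn0 addnK.
have c0 : cw 1 0 != 0 by apply/eqP=> /cw_eq0[/eqP]; rewrite oner_eq0.
split=> [|c /imsetP[ab _ ->] /wt_nz-> //].
by exists (cw 1 0); [apply/imsetP; exists (1, 0)|rewrite c0 wt_nz /=].
Qed.

End Code.

Theorem theorem1 (p m m1 m2 : nat) (F L1 L2 : finFieldType)
  (i1 : {rmorphism F -> L1}) (i2 : {rmorphism F -> L2})
  (Q : L1 -> F) (r : nat) (e : 'I_m1 -> L1) (lam : nat -> F) :
  prime p -> odd p -> (0 < m)%N -> #|F| = (p ^ m)%N ->
  (0 < m1)%N -> (0 < m2)%N ->
  #|L1| = (#|F| ^ m1)%N -> #|L2| = (#|F| ^ m2)%N ->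
  is_quadratic_form i1 Q -> (exists x, Q x != 0) ->
  r = rankQ m1 Q -> (1 <= r)%N -> diagonalizes i1 r Q e lam ->
  let q : nat := #|F| in
  let M : nat := (m1 + m2)%N in
  let C := codeQ i2 m2 Q in
  let eps : rat := epsQ p m r (\prod_(i < r) lam i) in
  let W1 : rat := q%:R ^+ M.-1 * (q%:R - 1) in
  let term0 : rat * (F -> rat) := (1 : rat, fun w : F => if w == 0 then (q ^ M - 1)%N%:R else 0) in
  let term1 : rat * (F -> rat) := (q%:R * (q%:R ^+ m2 - 1),
                fun w : F => if w == 0 then q%:R ^+ M.-1 - 1 else q%:R ^+ M.-1) in
  (~~ odd r ->
     let W2 : rat := W1 * (1 - eps * q%:R ^- (r %/ 2)) in
     [/\ #|Fstar L1 L2| = (q ^ M - 1)%N,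
         is_linear_code C,
         #|C| = (q ^ m2.+1)%N,
         (forall w : nat,
            (#|[set c in C | wt c == w]|)%:R =
              (w == 0%N)%:R + (w%:R == W1)%:R * (q%:R * (q%:R ^+ m2 - 1))
              + (w%:R == W2)%:R * (q%:R - 1) :> rat)
       & (forall k : {ffun F -> nat},
            (cwe_coef C k)%:R =
            poly_coef
              [:: term0; term1;
                  (q%:R - 1,
                   fun w : F =>
                     if w == 0
                     then q%:R ^+ M.-1 * (1 + eps * q%:R ^- (r %/ 2) * (q%:R - 1)) - 1
                     else q%:R ^+ M.-1 * (1 - eps * q%:R ^- (r %/ 2)))] k)])
  /\
  (odd r ->
     [/\ #|Fstar L1 L2| = (q ^ M - 1)%N,
         is_linear_code C,
         #|C| = (q ^ m2.+1)%N,
         (forall w : nat,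
            (#|[set c in C | wt c == w]|)%:R =
              (w == 0%N)%:R + (w%:R == W1)%:R * (q%:R ^+ m2.+1 - 1) :> rat)
       & 
         (forall k : {ffun F -> nat},
            (cwe_coef C k)%:R =
            poly_coef
              [:: term0; term1;
                  ((q%:R - 1) / 2%:R,
                   fun w : F =>
                     if w == 0 then q%:R ^+ M.-1 - 1
                     else q%:R ^+ M.-1 * (1 + eps * q%:R ^- ((r - 1) %/ 2) * qchar (- w)));
                  ((q%:R - 1) / 2%:R,
                   fun w : F =>
                     if w == 0 then q%:R ^+ M.-1 - 1
                     else q%:R ^+ M.-1 * (1 - eps * q%:R ^- ((r - 1) %/ 2) * qchar (- w)))] k)]
     /\ (meets_griesmer C m2.+1 <-> m1 = 1%N /\ r = 1%N)).
Proof.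
move=> pr_p odd_p _ cardF m1_gt0 m2_gt0 cardL1 cardL2 [Qhom _ _ _ _] Q_neq0 _ _ diagQ.
move=> q M C eps W1 term0 term1.
have cS : #|Fstar L1 L2| = (q ^ M - 1)%N by apply: card_Fstar.
have linC : is_linear_code C by apply: (codeQ_linear p m m2).
have cC : #|C| = (q ^ m2.+1)%N by apply: (card_codeQ p m m2 F L1 L2 i1).
have wtC := weight_distribution p m m1 m2 F L1 L2 i1 i2 Q r e lam pr_p odd_p cardF
  m1_gt0 m2_gt0 cardL1 cardL2 Qhom Q_neq0 diagQ.
split=> [even_r W2|odd_r].
  split=> // [w|k]; first by rewrite wtC (negbTE even_r) addrAC.
  exact: (cwe_even p m m1 m2 F L1 L2 i1 i2 Q r e lam).
split; last exact: (codeQ_griesmer p m m1 m2 F L1 L2 i1 i2 Q r e lam).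
split=> // [w|k]; last exact: (cwe_odd p m m1 m2 F L1 L2 i1 i2 Q r e lam).
(* For odd [r] the two nonzero weights coincide, and their frequencies add up to q^(m2+1) - 1. *)
by rewrite wtC odd_r -addrA -mulrDr; congr (_ + _ * _); rewrite exprS; ring.
Qed.
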